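(* Let $M$ be a simple matroid of rank $3$, let $c$ be the number of rank $2$ flats of $M$, and let $s$ be the sum of the sizes (numbers of elements) of the rank $2$ flats of $M$. If $3(c-1)<s$, then $M$ is non-orientable.
   Context: A matroid $M$ is given by a finite ground set $E$ and its lattice of flats; it is simple if its unique rank $0$ flat is $\varnothing$ and all of its rank $1$ flats are singletons. A matroid is orientable if it is the underlying matroid of some oriented matroid: for an oriented matroid $(E,\mathcal{C})$ with covector set $\mathcal{C}\subseteq\{+,-,0\}^E$, the underlying matroid is the one on $E$ whose flats are the zero sets $\{e\in E: X_e=0\}$ for $X\in\mathcal{C}$. Non-orientable means not orientable. *)

(* Defs.v *)
From HB Require Import structures.
From mathcomp Require Import all_boot.

Set Implicit Arguments.
Unset Strict Implicit.
Unset Printing Implicit Defensive.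

(** Matroids, given by their flats. *)

Definition covers (E : finType) (F : {set {set E}}) (A B : {set E}) : Prop :=
  [/\ B \in F, A \proper B &
      forall C, C \in F -> A \proper C -> ~~ (C \proper B)].

(* [flats_cover] says that the sets [B :\: A], for [B] a flat covering [A],
   partition [~: A]. *)
Record matroid (E : finType) := Matroid {
  flats : {set {set E}};
  flatsT : [set: E] \in flats;
  flatsI : forall A B, A \in flats -> B \in flats -> A :&: B \in flats;
  flats_cover : forall A e, A \in flats -> e \notin A ->
    exists! B, covers flats A B /\ e \in B
}.

Section MatroidRank.
Variables (E : finType) (M : matroid E).

Definition is_chain (K : {set {set E}}) : bool :=
  [forall A in K, forall B in K, (A \subset B) || (B \subset A)].

(* The rank of a flat [A] is its height in the lattice of flats: a chain
   [A_0 < ... < A_(k-1) < A] of flats has length [k], the number of its members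
   other than [A]. *)
Definition rank_flat (A : {set E}) : nat :=
  \max_(K : {set {set E}} |
          [&& K \subset flats M, is_chain K & [forall B in K, B \proper A]])
    #|K|.

Definition rank : nat := rank_flat [set: E].

Definition flats_of_rank (k : nat) : {set {set E}} :=
  [set A in flats M | rank_flat A == k].

Definition simple_matroid : Prop :=
  flats_of_rank 0 = [set set0] /\
  (forall A, A \in flats_of_rank 1 -> exists e, A = [set e]).

End MatroidRank.

(** Oriented matroids, given by their covectors. *)

Inductive sign := Pos | Neg | Zero.

Definition bool_of_sign (s : sign) : option bool :=
  match s with Pos => Some true | Neg => Some false | Zero => None end.

Definition sign_of_bool (b : option bool) : sign :=
  match b with Some true => Pos | Some false => Neg | None => Zero end.

Lemma bool_of_signK : cancel bool_of_sign sign_of_bool.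
Proof. by case. Qed.

HB.instance Definition _ := Finite.copy sign (can_type bool_of_signK).

Definition opp_sign (s : sign) : sign :=
  match s with Pos => Neg | Neg => Pos | Zero => Zero end.

Section SignVectors.
Variable E : finType.
Implicit Types X Y : {ffun E -> sign}.

Definition sv0 : {ffun E -> sign} := [ffun=> Zero].

Definition sv_opp X : {ffun E -> sign} := [ffun e => opp_sign (X e)].

Definition sv_comp X Y : {ffun E -> sign} :=
  [ffun e => if X e == Zero then Y e else X e].

Definition separation X Y : {set E} :=
  [set e | (X e != Zero) && (Y e == opp_sign (X e))].

Definition zero_set X : {set E} := [set e | X e == Zero].

End SignVectors.

Record oriented_matroid (E : finType) := OrientedMatroid {
  covectors : {set {ffun E -> sign}};
  covectors0 : sv0 E \in covectors;
  covectorsN : forall X, X \in covectors -> sv_opp X \in covectors;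
  covectorsC : forall X Y, X \in covectors -> Y \in covectors ->
    sv_comp X Y \in covectors;
  covectors_elim : forall X Y e, X \in covectors -> Y \in covectors ->
    e \in separation X Y ->
    exists Z, [/\ Z \in covectors, Z e = Zero &
      forall f, f \notin separation X Y ->
        Z f = sv_comp X Y f /\ Z f = sv_comp Y X f]
}.

Section Underlying.
Variables (E : finType) (O : oriented_matroid E).

Definition zero_sets : {set {set E}} :=
  [set zero_set X | X in covectors O].

Lemma zero_setsT : [set: E] \in zero_sets.
Proof.
apply/imsetP; exists (sv0 E); first exact: covectors0.
by apply/setP=> e; rewrite !inE ffunE eqxx.
Qed.

Lemma zero_setsI A B :
  A \in zero_sets -> B \in zero_sets -> A :&: B \in zero_sets.
Proof.
move=> /imsetP[X XO ->] /imsetP[Y YO ->].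
apply/imsetP; exists (sv_comp X Y); first exact: covectorsC.
by apply/setP=> e; rewrite !inE ffunE; case: (X e =P Zero) => //= /eqP/negPf->.
Qed.

Lemma zero_sets_sep A C e f :
  A \in zero_sets -> C \in zero_sets -> A \subset C ->
  e \notin C -> f \in C -> f \notin A ->
  exists2 B, B \in zero_sets & [/\ A \subset B, e \in B & f \notin B].
Proof.
move=> /imsetP[X XO ->] /imsetP[Y0 Y0O ->] /subsetP sXY0 eY0 fY0 fX.
have eX : X e != Zero by apply: contra eY0 => Xe0; apply: sXY0; rewrite inE.
have [Y [YO zY Ye]] : exists Y, [/\ Y \in covectors O,
    zero_set Y = zero_set Y0 & Y e = opp_sign (X e)].
  have [eq|ne] := Y0 e =P opp_sign (X e); first by exists Y0.
  exists (sv_opp Y0); split; first exact: covectorsN.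
  - by apply/setP=> g; rewrite !inE ffunE; case: (Y0 g).
  - move: eX eY0 ne; rewrite inE ffunE.
    by case: (X e); case: (Y0 e) => //=; rewrite ?eqxx.
have eS : e \in separation X Y by rewrite inE eX Ye eqxx.
have [Z [ZO Ze Zf]] := covectors_elim XO YO eS.
exists (zero_set Z); first by apply: imset_f.
move: fX fY0 sXY0; rewrite -zY !inE => fX /eqP fY sXY; split.
- apply/subsetP=> g gX; have gY := sXY g gX.
  move: gX gY; rewrite !inE => /eqP gX /eqP gY.
  have [->] : Z g = sv_comp X Y g /\ Z g = sv_comp Y X g.
    by apply: Zf; rewrite inE gX eqxx.
  by rewrite ffunE gX eqxx gY.
- by rewrite Ze.
- have [->] : Z f = sv_comp X Y f /\ Z f = sv_comp Y X f.
    by apply: Zf; rewrite inE fX fY; case: (X f) fX.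
  by rewrite ffunE (negPf fX).
Qed.

Lemma zero_sets_cover A e : A \in zero_sets -> e \notin A ->
  exists! B, covers zero_sets A B /\ e \in B.
Proof.
move=> AF eA.
pose P := [pred B | [&& B \in zero_sets, A \subset B & e \in B]].
have PT : P [set: E] by rewrite /= zero_setsT subsetT inE.
pose B := [arg min_(B < [set: E] | P B) #|B|].
have [BF AB eB minB] :
    [/\ B \in zero_sets, A \subset B, e \in B &
        forall C, P C -> B \subset C].
  rewrite /B; case: arg_minnP => // {}B /and3P[BF AB eB] minB.
  split=> // C /and3P[CF AC eC].
  have /minB le : P (B :&: C).
    by rewrite /= zero_setsI // subsetI AB AC inE eB eC.
  by apply/setIidPl/eqP; rewrite eqEcard subsetIl le.
have pAB : A \proper B by apply/properP; split=> //; exists e.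
exists B; split.
  split=> //; split=> // C CF /properP[AC [f fC fA]].
  apply/negP=> /properP[CB [g gB gC]].
  have [eC|eC] := boolP (e \in C).
    have /subsetP/(_ g gB) : B \subset C by apply: minB; rewrite /= CF AC eC.
    by rewrite (negPf gC).
  have [D DF [AD eD fD]] := zero_sets_sep AF CF AC eC fC fA.
  have /subsetP/(_ f) : B \subset D by apply: minB; rewrite /= DF AD eD.
  by rewrite (subsetP CB) // (negPf fD) => /(_ isT).
move=> C [[CF pAC minC] eC].
have BC : B \subset C by apply: minB; rewrite /= CF (proper_sub pAC) eC.
by apply/eqP; have := minC B BF pAB; rewrite properE BC negbK eqEsubset BC.
Qed.

Definition underlying : matroid E :=
  Matroid zero_setsT zero_setsI zero_sets_cover.

End Underlying.

(* Two matroids on [E] are the same when they have the same flats. *)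
Definition orientable (E : finType) (M : matroid E) : Prop :=
  exists O : oriented_matroid E, flats (underlying O) = flats M.

(* Main.v *)
Require Import Defs.
From mathcomp Require Import all_boot all_order all_algebra.
From mathcomp Require Import zify.

Set Implicit Arguments.
Unset Strict Implicit.
Unset Printing Implicit Defensive.

(** The contrapositive is Melchior's inequality for pseudoline arrangements:
    if [M] is orientable then [s <= 3 * c - 3].

    An orientation of [M] is an arrangement of pseudolines in the projective
    plane, drawn on its double cover, the sphere. Each element [e] is a closed
    curve, and each rank 2 flat [L] is a pair of antipodal points, where the
    curves of the elements of [L] meet. A curve [e] is cut into twice as many
    arcs as there are lines [L] containing [e], so there are [2 * s] arcs and
    [2 * c] vertices, and Euler's formula gives [2 + 2 * s - 2 * c] regions.
    A region has at least three sides and an arc borders two regions, hence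
    [3 * (2 + 2 * s - 2 * c) <= 4 * s], which is the inequality.

    With covectors in place of the sphere, a region is a tope and an arc is a
    covector whose zero set is one point. Euler's formula comes from adding
    the curves one at a time ([card_cells_split]): a new curve cuts exactly
    those cells that contain an arc of it. The same recursion, one dimension
    lower, counts the arcs on a curve ([card_cells_point]), where the new
    objects are pairs of antipodal points ([card_cells_cocircuit]); summing
    over the curves counts the regions ([card_cells_plane]).

    That a tope has three sides ([facets_ge3]) follows from the fact that a
    tope is cut out by its facets ([covector_facet]): for any two elements
    there is a third one off the line that they span, and on the curve of this
    third element some covector agrees with the tope at the first two. *)

Lemma set_ind (T : finType) (P : {set T} -> Prop) :
  P set0 -> (forall x (S : {set T}), x \notin S -> P S -> P (x |: S)) ->
  forall S, P S.
Proof.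
move=> P0 PU S; have [n] := ubnP #|S|; elim: n S => // n IHn S leSn.
have [->|[x xS]] := set_0Vmem S; first exact: P0.
rewrite -(setD1K xS); apply: PU; first by rewrite !inE eqxx.
by apply: IHn; move: leSn; rewrite (cardsD1 x S) xS.
Qed.

(** * Rank in the lattice of flats *)

Section Rank.
Variables (E : finType) (M : matroid E).
Implicit Types A B C L : {set E}.

Lemma rank_flat_mono A B :
  A \in flats M -> A \proper B -> rank_flat M A < rank_flat M B.
Proof.
move=> AF pAB; rewrite {1}/rank_flat.
have nonempty : 0 < #|[pred K : {set {set E}} | [&& K \subset flats M,
    is_chain K & [forall C in K, C \proper A]]]|.
  apply/card_gt0P; exists set0; rewrite inE sub0set /=.
  by apply/andP; split; apply/forall_inP=> C; rewrite inE.
have [K /and3P[sKF chK ltKA] ->] :=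
  eq_bigmax_cond (fun K : {set {set E}} => #|K|) nonempty.
have AK : A \notin K.
  by apply/negP=> /(forall_inP ltKA); rewrite properxx.
rewrite -add1n -[1]/(true : nat) -AK -cardsU1.
apply: (leq_bigmax_cond (A |: K)); apply/and3P; split.
- by rewrite subUset sub1set AF.
- apply/forall_inP=> C; rewrite !inE => /predU1P[->|CK]; apply/forall_inP=> D;
    rewrite !inE => /predU1P[->|DK].
  + by rewrite subxx.
  + by rewrite (proper_sub (forall_inP ltKA _ DK)) orbT.
  + by rewrite (proper_sub (forall_inP ltKA _ CK)).
  + exact: (forall_inP (forall_inP chK _ CK)).
- apply/forall_inP=> C; rewrite !inE => /predU1P[->//|CK].
  exact: proper_trans (forall_inP ltKA _ CK) pAB.
Qed.

(** A longest chain below [B] is its largest member on top of a chain below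
    that member. *)
Lemma rank_flat_le B k :
    (forall C, C \in flats M -> C \proper B -> rank_flat M C <= k) ->
  rank_flat M B <= k.+1.
Proof.
move=> le_k; apply/bigmax_leqP=> K /and3P[/subsetP sKF chK ltKB].
have [->|[C0 C0K]] := set_0Vmem K; first by rewrite cards0.
case: (arg_maxnP (fun C : {set E} => #|C|) C0K) => C CK maxC.
have {}CK : C \in K by [].
rewrite (cardsD1 C K) CK ltnS.
apply: leq_trans (le_k C (sKF C CK) (forall_inP ltKB _ CK)).
apply: (leq_bigmax_cond (K :\ C)); apply/and3P; split.
- by apply/subsetP=> D /setD1P[_ /sKF].
- apply/forall_inP=> D /setD1P[_ DK]; apply/forall_inP=> D' /setD1P[_ D'K].
  exact: (forall_inP (forall_inP chK _ DK)).
- apply/forall_inP=> D /setD1P[neDC DK].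
  have /orP[sDC|sCD] := forall_inP (forall_inP chK _ DK) _ CK.
    by rewrite properEneq neDC.
  by case/eqP: neDC; apply/esym/eqP; rewrite eqEcard sCD; apply: maxC.
Qed.

(** A cover of [A] is the least flat above [A] containing any one of its new
    elements, since meeting it with another such flat stays above [A]. *)
Lemma covers_min A B C f : covers (flats M) A B ->
  f \in B -> f \notin A -> C \in flats M -> A \subset C -> f \in C ->
  B \subset C.
Proof.
move=> [BF pAB minB] fB fA CF sAC fC.
have pABC : A \proper B :&: C.
  apply/properP; split; last by exists f; rewrite // inE fB.
  by rewrite subsetI (proper_sub pAB).
have := minB _ (flatsI BF CF) pABC.
by rewrite properE subsetIl negbK subsetI subxx.
Qed.

End Rank.

(** * Points and lines of a simple matroid *)

Section PointsAndLines.
Variables (E : finType) (M : matroid E).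
Hypothesis simpleM : simple_matroid M.
Implicit Types A B C L : {set E}.

Let lines := flats_of_rank M 2.

Lemma flat0_rank : set0 \in flats M /\ rank_flat M set0 = 0.
Proof.
have [/setP/(_ set0)] := simpleM.
by rewrite !inE eqxx => /andP[-> /eqP->].
Qed.

Lemma flat1_rank e : [set e] \in flats M /\ rank_flat M [set e] = 1.
Proof.
have [F0 r0] := flat0_rank.
have [B [[[BF p0B minB] eB] _]] := flats_cover F0 (negbT (in_set0 e)).
have rB : rank_flat M B = 1.
  apply/eqP; rewrite eqn_leq -{2}r0 rank_flat_mono // andbT.
  apply: rank_flat_le => C CF pCB.
  have [->|[x xC]] := set_0Vmem C; first by rewrite r0.
  have p0C : set0 \proper C by rewrite proper0; apply/set0Pn; exists x.
  by have := minB C CF p0C; rewrite pCB.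
have [x eqB] : exists x, B = [set x].
  by apply: simpleM.2; rewrite inE BF rB eqxx.
by move: eB BF rB; rewrite eqB !inE => /eqP->.
Qed.

Lemma flat1 e : [set e] \in flats M. Proof. exact: (flat1_rank e).1. Qed.

(** Steinitz exchange: any two elements of the line spanned by [e] and another
    element span that line. *)
Lemma cover_exchange e f g B : covers (flats M) [set e] B ->
  f \in B -> g \in B -> f != g -> covers (flats M) [set f] B.
Proof.
have swap x y : covers (flats M) [set x] B -> y \in B -> y != x ->
    covers (flats M) [set y] B.
  move=> cov yB neyx; have [BF pxB minB] := cov.
  have xB : x \in B by rewrite -sub1set proper_sub.
  have [D [[[DF pyD minD] xD] _]] : exists! D,
      covers (flats M) [set y] D /\ x \in D.
    by apply: flats_cover; rewrite ?flat1 // inE eq_sym.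
  have yD : y \in D by rewrite -sub1set proper_sub.
  have sDB : D \subset B.
    apply: (covers_min (f := x) (And3 DF pyD minD)) => //.
      by rewrite inE eq_sym.
    by rewrite sub1set.
  have sBD : B \subset D.
    by apply: (covers_min (f := y) cov); rewrite // ?inE // sub1set.
  by have <- : D = B; [apply/eqP; rewrite eqEsubset sDB | split].
move=> cov fB gB nefg; have [-> //|nefe] := eqVneq f e.
exact: swap cov fB nefe.
Qed.

(** The empty set and the point [e] form a chain below [B], so the rank of [B]
    is at least 2. It is no more, because two elements of [B] already span [B],
    so that a flat strictly inside [B] has at most one element. *)
Lemma cover1_line e B :
  covers (flats M) [set e] B -> B \in lines.
Proof.
move=> cov; have [BF peB _] := cov.
rewrite inE BF eqn_leq /=; apply/andP; split; last first.
  by have := rank_flat_mono (flat1 e) peB; rewrite (flat1_rank e).2.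
apply: rank_flat_le => C CF pCB.
have [->|[x xC]] := set_0Vmem C; first by rewrite flat0_rank.2.
suff -> : C = [set x] by rewrite (flat1_rank x).2.
apply/eqP; rewrite eqEsubset sub1set xC andbT.
apply/subsetP=> y yC; rewrite inE; apply: contraT => neyx.
have sCB := subsetP (proper_sub pCB).
have covx : covers (flats M) [set x] B.
  by apply: (cover_exchange cov (sCB x xC) (sCB y yC)); rewrite eq_sym.
suff sBC : B \subset C by have := proper_subn pCB; rewrite sBC.
apply: (covers_min covx (sCB y yC)) => //.
  by rewrite inE.
by rewrite sub1set.
Qed.

Lemma line_through e f : e != f ->
  exists L, [/\ L \in lines, e \in L & f \in L].
Proof.
move=> neef.
have [B [[cov fB] _]] : exists! B, covers (flats M) [set e] B /\ f \in B.
  by apply: flats_cover; rewrite ?flat1 // inE eq_sym.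
exists B; split=> //; first exact: cover1_line cov.
by case: cov => _ /proper_sub; rewrite sub1set.
Qed.

Lemma line_flat L : L \in lines -> L \in flats M.
Proof. by rewrite inE => /andP[]. Qed.

(** The flat spanned by [e] and [f] lies in [L], and it is all of [L] because it
    has rank 2 as well. *)
Lemma line_sub L C e f : L \in lines -> e \in L -> f \in L -> e != f ->
  C \in flats M -> e \in C -> f \in C -> L \subset C.
Proof.
move=> lineL eL fL neef CF eC fC.
have [B [[cov fB] _]] : exists! B, covers (flats M) [set e] B /\ f \in B.
  by apply: flats_cover; rewrite ?flat1 // inE eq_sym.
have sBL : B \subset L.
  by apply: (covers_min cov fB); rewrite ?line_flat ?sub1set // inE eq_sym.
have peB : [set e] \proper B by case: cov.
suff <- : B = L.
  by apply: (covers_min cov fB); rewrite // ?sub1set // inE eq_sym.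
apply/eqP/contraT => neBL.
have := rank_flat_mono (line_flat (cover1_line cov)).
have /andP[_ /eqP rB] : (B \in flats M) && (rank_flat M B == 2).
  by have := cover1_line cov; rewrite inE.
have /andP[_ /eqP rL] : (L \in flats M) && (rank_flat M L == 2).
  by move: lineL; rewrite inE.
by move/(_ L); rewrite properEneq neBL sBL rB rL => /(_ isT).
Qed.

Lemma line_unique L K e f : L \in lines -> K \in lines -> e != f ->
  e \in L -> f \in L -> e \in K -> f \in K -> L = K.
Proof.
move=> lineL lineK neef eL fL eK fK; apply/eqP; rewrite eqEsubset.
by rewrite (line_sub lineL eL fL) ?(line_sub lineK eK fK) ?line_flat.
Qed.

Lemma line_coatom L C : rank M = 3 -> L \in lines -> C \in flats M ->
  L \proper C -> C = setT.
Proof.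
move=> rankM lineL CF pLC; apply/eqP/contraT => neCT.
have rL : rank_flat M L = 2 by move: lineL; rewrite inE => /andP[_ /eqP].
have rC := rank_flat_mono (line_flat lineL) pLC.
have : rank_flat M C < rank M.
  by apply: rank_flat_mono; rewrite // properEneq neCT subsetT.
by rewrite rankM; lia.
Qed.

Lemma line_neq0 L : L \in lines -> 0 < #|L|.
Proof.
rewrite inE card_gt0 => /andP[_ /eqP rL]; apply/eqP=> eqL0.
by move: rL; rewrite eqL0 flat0_rank.2.
Qed.

End PointsAndLines.

(** * Counting the cells of a partial arrangement *)

Section Cells.
Variables (E : finType) (O : oriented_matroid E).
Implicit Types (X Y Z : {ffun E -> sign}) (A S L : {set E}).

Definition restrict S X : {ffun E -> sign} :=
  [ffun e => if e \in S then X e else Zero].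

(** The regions that the curves of [S] cut out of the flat of [A]: the topes of
    the restriction to [S] of the contraction by [A]. They are kept as sign
    vectors on all of [E], zero outside [S], so that no change of ground set
    occurs. *)
Definition cells A S : {set {ffun E -> sign}} :=
  [set restrict S X | X in [set X in covectors O |
     [forall e in A, X e == Zero] && [forall e in S, X e != Zero]]].

Lemma cellsP A S Y :
  reflect (exists X, [/\ X \in covectors O, {in A, forall e, X e = Zero},
             {in S, forall e, X e != Zero} & Y = restrict S X])
          (Y \in cells A S).
Proof.
apply: (iffP imsetP) => [[X] | [X [XO XA XS ->]]].
  rewrite inE => /and3P[XO /forall_inP XA /forall_inP XS] ->.
  by exists X; split=> // e /XA/eqP.
exists X => //; rewrite inE XO /=.
by apply/andP; split; apply/forall_inP => e; [move/XA/eqP | apply: XS].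
Qed.

Lemma restrict_eqP S X Y :
  reflect {in S, X =1 Y} (restrict S X == restrict S Y).
Proof.
apply: (iffP eqP) => [/ffunP eqXY e eS | eqXY].
  by have := eqXY e; rewrite !ffunE eS.
by apply/ffunP=> e; rewrite !ffunE; case: ifP => // /eqXY.
Qed.

Lemma comp_zero X Y e : X e = Zero -> Y e = Zero -> sv_comp X Y e = Zero.
Proof. by rewrite ffunE => ->. Qed.

Lemma comp_nonzero X Y e : X e != Zero -> sv_comp X Y e = X e.
Proof. by rewrite ffunE => /negPf->. Qed.

Lemma comp_at_zero X Y e : X e = Zero -> sv_comp X Y e = Y e.
Proof. by rewrite ffunE => ->. Qed.

Lemma covector_signed A e s V : V \in covectors O ->
    {in A, forall f, V f = Zero} -> V e != Zero -> s != Zero ->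
  exists U, [/\ U \in covectors O, {in A, forall f, U f = Zero} & U e = s].
Proof.
move=> VO VA Ve s0; have [eqV | neV] := eqVneq (V e) s; first by exists V.
exists (sv_opp V); split; first exact: covectorsN.
  by move=> f fA; rewrite ffunE VA.
by rewrite ffunE; move: Ve s0 neV; case: (V e); case: s.
Qed.

(** Adding the curve [e] cuts in two precisely those cells of [S] that meet it:
    if both extensions of a cell by a sign at [e] occur, eliminating [e] between
    them gives a covector of the cell lying on [e]; conversely such a covector
    can be pushed to either side of [e] by composing it with [V] or with its
    opposite. Hence the two sides of [e] have all the cells of [S] as their
    union and the cells on [e] as their intersection. *)
Lemma card_cells_split A S e V : e \notin S -> V \in covectors O ->
    {in A, forall f, V f = Zero} -> V e != Zero ->
  #|cells A (e |: S)| = #|cells A S| + #|cells (e |: A) S|.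
Proof.
move=> eS VO VA Ve.
pose side s := [set Y in cells A (e |: S) | Y e == s].
have sideP s Y : s != Zero -> reflect (exists X, [/\ X \in covectors O,
    {in A, forall f, X f = Zero}, {in S, forall f, X f != Zero}, X e = s &
    Y = restrict (e |: S) X]) (Y \in side s).
  move=> s0; rewrite inE; apply: (iffP andP) => [[/cellsP[X [XO XA XS ->]]] | ].
    rewrite ffunE setU11 => /eqP Xe; exists X; split=> // f fS.
    by apply: XS; rewrite inE fS orbT.
  case=> X [XO XA XS Xe ->]; split; last by rewrite ffunE setU11 Xe.
  apply/cellsP; exists X; split=> // f; rewrite !inE => /predU1P[->|/XS//].
  by rewrite Xe.
have restrU X : restrict S (restrict (e |: S) X) = restrict S X.
  by apply/eqP/restrict_eqP => f fS; rewrite ffunE inE fS orbT.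
have restrE s Y : s != Zero ->
  reflect (exists X, [/\ X \in covectors O, {in A, forall f, X f = Zero},
             {in S, forall f, X f != Zero}, X e = s & Y = restrict S X])
          (Y \in restrict S @: side s).
  move=> s0; apply: (iffP imsetP).
    case=> _ /(sideP _ _ s0)[X [XO XA XS Xe ->]] ->.
    by exists X.
  case=> X [XO XA XS Xe ->]; exists (restrict (e |: S) X); last by [].
  by apply/sideP => //; exists X.
have card_side s : #|restrict S @: side s| = #|side s|.
  apply: card_in_imset => Y1 Y2.
  rewrite !inE => /andP[/cellsP[X1 [_ _ _ ->]] /eqP X1e].
  move=> /andP[/cellsP[X2 [_ _ _ ->]] /eqP X2e].
  rewrite !restrU => /eqP/restrict_eqP eqX; apply/eqP/restrict_eqP => f.
  rewrite !inE => /predU1P[->|/eqX//].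
  by move: X1e X2e; rewrite !ffunE setU11 => -> ->.
have -> : cells A (e |: S) = side Pos :|: side Neg.
  apply/setP=> Y; rewrite !inE -andb_orr andb_idr // => /cellsP[X [_ _ XS ->]].
  have := XS e; rewrite ffunE !inE eqxx /= => /(_ isT).
  by case: (X e).
rewrite cardsU (_ : side Pos :&: side Neg = set0) ?cards0 ?subn0; last first.
  apply/setP=> Y; rewrite !inE; apply/negP.
  by move=> /andP[/andP[_ /eqP->] /andP[_]].
rewrite -(card_side Pos) -(card_side Neg) -cardsUI; congr (_ + _).
  apply: eq_card => Y; rewrite in_setU.
  apply/orP/cellsP => [[] /restrE[]// X [XO XA XS _ ->] | ]; try by exists X.
  case=> X [XO XA XS ->].
  have [Xe0|Xe] := eqVneq (X e) Zero.
    have [U [UO UA Ue]] := covector_signed VO VA Ve (isT : Pos != Zero).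
    left; apply/restrE => //; exists (sv_comp X U); split.
    - exact: covectorsC.
    - by move=> f fA; rewrite comp_zero ?XA ?UA.
    - by move=> f fS; rewrite comp_nonzero XS.
    - by rewrite comp_at_zero.
    - by apply/eqP/restrict_eqP => f fS; rewrite comp_nonzero ?XS.
  case Xes : (X e) Xe => // _; [left | right];
    by apply/restrE => //; exists X.
apply: eq_card => Y; rewrite in_setI.
apply/andP/cellsP => [[] | [X [XO XA XS ->]]].
  move=> /restrE[]// X1 [X1O X1A X1S X1e ->].
  move=> /restrE[]// X2 [X2O X2A X2S X2e /eqP/restrict_eqP eqX].
  have sep_e : e \in separation X1 X2 by rewrite inE X1e X2e.
  have [Z [ZO Ze Zf]] := covectors_elim X1O X2O sep_e.
  have ZS : {in S, Z =1 X1}.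
    move=> f fS; have [|->] := Zf f; last by rewrite comp_nonzero ?X1S.
    by rewrite inE -eqX //; have := X1S f fS; case: (X1 f).
  exists Z; split=> //.
  - move=> f; rewrite !inE => /predU1P[->//|fA].
    have [|->] := Zf f; last by rewrite comp_zero ?X1A ?X2A.
    by rewrite inE X1A.
  - by move=> f fS; rewrite ZS ?X1S.
  - by apply/esym/eqP/restrict_eqP.
have Xe : X e = Zero by apply: XA; rewrite setU11.
suff extend s : s != Zero -> restrict S X \in restrict S @: side s.
  by split; apply: extend.
move=> s0; have [U [UO UA Ue]] := covector_signed VO VA Ve s0.
apply/restrE => //; exists (sv_comp X U); split.
- exact: covectorsC.
- by move=> f fA; rewrite comp_zero ?UA // XA // inE fA orbT.
- by move=> f fS; rewrite comp_nonzero XS.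
- by rewrite comp_at_zero.
- by apply/eqP/restrict_eqP => f fS; rewrite comp_nonzero ?XS.
Qed.

Lemma card_cells0 A : #|cells A set0| = 1.
Proof.
apply/eqP/cards1P; exists (sv0 E); apply/setP=> Y; rewrite inE.
apply/cellsP/eqP => [[X [_ _ _ ->]] | ->].
  by apply/ffunP=> e; rewrite !ffunE inE.
exists (sv0 E); split=> [||e|]; rewrite ?covectors0 ?inE //.
  by move=> e _; rewrite ffunE.
by apply/ffunP=> e; rewrite !ffunE inE.
Qed.

(** A cell cannot avoid a curve [g] that contains the whole flat of [A]. *)
Lemma cells_degenerate A S g : g \in S ->
    (forall X, X \in covectors O -> {in A, forall f, X f = Zero} ->
      X g = Zero) ->
  cells A S = set0.
Proof.
move=> gS Ag; apply/setP=> Y; rewrite inE; apply/cellsP.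
by case=> X [XO /(Ag X XO) Xg XS _]; have := XS g gS; rewrite Xg.
Qed.

(** If [X] and [Y] are separated at [e] but agree at some [f] outside [L], then
    eliminating [e] gives a covector that vanishes on [L] and at [e] but not at
    [f], against the maximality of [L]. *)
Lemma cocircuit_unique L X Y :
    (forall C, C \in zero_sets O -> L \proper C -> C = setT) ->
    X \in covectors O -> Y \in covectors O ->
    zero_set X = L -> zero_set Y = L -> Y = X \/ Y = sv_opp X.
Proof.
move=> coatomL XO YO zX zY.
have zXe e : (X e == Zero) = (e \in L) by rewrite -zX inE.
have zYe e : (Y e == Zero) = (e \in L) by rewrite -zY inE.
have [sep0|[e eS]] := set_0Vmem (separation X Y).
  left; apply/ffunP => e; have := in_set0 e; rewrite -sep0 inE.
  by have := zXe e; rewrite -zYe; case: (X e); case: (Y e).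
right; have [Z [ZO Ze Zf]] := covectors_elim XO YO eS.
have eL : e \notin L by move: eS; rewrite inE zXe => /andP[].
have sepL f : f \in L -> f \notin separation X Y.
  by rewrite inE zXe => ->.
have ZT : zero_set Z = setT.
  apply: coatomL; first exact: imset_f.
  apply/properP; split; last by exists e; rewrite // inE Ze.
  apply/subsetP=> f fL; rewrite inE; have [-> _] := Zf f (sepL f fL).
  by apply/eqP; apply: comp_zero; apply/eqP; rewrite ?zXe ?zYe.
apply/ffunP=> f; rewrite ffunE.
have [fS|/Zf[Zf1 _]] := boolP (f \in separation X Y).
  by move: fS; rewrite inE => /andP[_ /eqP].
have /eqP Zf0 : Z f == Zero by have := in_setT f; rewrite -ZT inE.
have := zXe f; rewrite -zYe; move: Zf1; rewrite Zf0 ffunE.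
by case: (X f); case: (Y f).
Qed.

(** In the contraction by a hyperplane [L] only the two antipodal points carried
    by [L] remain. *)
Lemma card_cells_cocircuit A S L :
    (forall C, C \in zero_sets O -> L \proper C -> C = setT) ->
    L \in zero_sets O ->
    (forall C, C \in zero_sets O -> A \subset C -> L \subset C) ->
    A \subset L -> S != set0 -> [disjoint S & L] ->
  #|cells A S| = 2.
Proof.
move=> coatomL /imsetP[X XO zX] closL sAL /set0Pn[g gS] disSL.
have XS f : f \in S -> X f != Zero.
  by move/(disjointFr disSL); rewrite zX inE => ->.
have -> : cells A S = [set restrict S X; restrict S (sv_opp X)].
  apply/setP=> Y; rewrite !inE; apply/cellsP/orP => [[Z [ZO ZA ZS ->]] | ].
    have zZ : zero_set Z = L.
      have sLZ : L \subset zero_set Z.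
        apply: closL; first exact: imset_f.
        by apply/subsetP=> f fA; rewrite inE ZA.
      apply/eqP; rewrite eqEsubset sLZ andbT; apply: contraT => nsZL.
      have /setP/(_ g) : zero_set Z = setT.
        apply: coatomL; first exact: imset_f.
        by rewrite properE sLZ.
      by rewrite !inE (negPf (ZS g gS)).
    by case: (cocircuit_unique coatomL XO ZO) => // ->; rewrite eqxx;
      [left | right].
  have XA f : f \in A -> X f = Zero.
    by move/(subsetP sAL); rewrite zX inE => /eqP.
  case=> /eqP->; [exists X | exists (sv_opp X)]; split=> //.
  - exact: covectorsN.
  - by move=> f fA; rewrite ffunE XA.
  - by move=> f /XS; rewrite ffunE; case: (X f).
rewrite cards2; case: restrict_eqP => // /(_ g gS).
by have := XS g gS; rewrite ffunE; case: (X g).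
Qed.

End Cells.

(** * Facets of topes *)

Section Topes.
Variables (E : finType) (O : oriented_matroid E).
Implicit Types (X Y Z V : {ffun E -> sign}) (S : {set E}).
Hypothesis simpleO : forall e f, e != f ->
  exists V, [/\ V \in covectors O, V e = Zero & V f != Zero].

Definition topes := [set Y in covectors O | zero_set Y == set0].

Definition facet Y e : {ffun E -> sign} :=
  [ffun f => if f == e then Zero else Y f].

(** The elements carrying a side of the region [Y]: those whose curve can be
    reached from [Y] without crossing another one. *)
Definition facets Y : {set E} := [set e | facet Y e \in covectors O].

Lemma topesP Y : reflect (Y \in covectors O /\ forall e, Y e != Zero)
                         (Y \in topes).
Proof.
rewrite inE; apply: (iffP andP) => [[YO /eqP/setP Y0] | [YO Y0]]; split=> //.
  by move=> e; have := Y0 e; rewrite !inE => ->.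
by apply/eqP/setP=> e; rewrite !inE (negPf (Y0 e)).
Qed.

Lemma tope_comp X Y : X \in covectors O -> Y \in topes -> sv_comp X Y \in topes.
Proof.
move=> XO /topesP[YO Y0]; apply/topesP; split; first exact: covectorsC.
by move=> e; rewrite ffunE; case: ifP => // /negbT.
Qed.

Lemma tope_opp Y : Y \in topes -> sv_opp Y \in topes.
Proof.
move=> /topesP[YO Y0]; apply/topesP; split; first exact: covectorsN.
by move=> e; have := Y0 e; rewrite ffunE; case: (Y e).
Qed.

Lemma tope_sep Y Z e : Y \in topes -> Z \in topes ->
  (e \in separation Y Z) = (Z e != Y e).
Proof.
move=> /topesP[_ /(_ e) Ye] /topesP[_ /(_ e) Ze]; rewrite inE.
by case: (Y e) Ye; case: (Z e) Ze.
Qed.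

(** Among the topes other than [Y] that are separated from [Y] only inside
    [separation Y Z], let [V] be one with the fewest separating elements; then
    [separation Y V] is a single element. Indeed eliminating some [e] between
    [Y] and [V] gives a covector [W] which is [Y] off [separation Y V], and
    minimality forces it to vanish on all of [separation Y V]. So [W] composed
    with any tope is either [Y] or separated from [Y] on all of
    [separation Y V]: every tope has the sign of [Y] at all those elements or at
    none. By simplicity the signs at two elements are not tied in this way. Thus
    [W] is [Y] with its entry at [e] made zero. *)
Lemma facet_separates Y Z : Y \in topes -> Z \in topes -> Z != Y ->
  exists2 e, e \in facets Y & Z e != Y e.
Proof.
move=> Yt Zt neZY.
have [YO Y0] := topesP _ Yt.
pose P := [pred V | [&& V \in topes, V != Y &
                     separation Y V \subset separation Y Z]].
have PZ : P Z by rewrite /= Zt neZY subxx.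
case: (arg_minnP (fun V => #|separation Y V|) PZ) => V /and3P[Vt neVY sVZ] minV.
have [VO V0] := topesP _ Vt.
have minsep U : U \in topes -> separation Y U \subset separation Y V ->
    U = Y \/ separation Y U = separation Y V.
  move=> Ut sUV; have [|neUY] := eqVneq U Y; first by left.
  right; apply/eqP; rewrite eqEcard sUV minV //.
  by rewrite /= Ut neUY (subset_trans sUV).
have [e eS] : exists e, e \in separation Y V.
  apply/set0Pn; apply: contra neVY => /eqP sep0; apply/eqP/ffunP=> e.
  by apply/eqP; rewrite -[_ == _]negbK -tope_sep // sep0 inE.
have [W [WO We Wf]] := covectors_elim YO VO eS.
have WY f : f \notin separation Y V -> W f = Y f.
  by case/Wf=> -> _; rewrite comp_nonzero.
have sepW U : U \in topes ->
    separation Y (sv_comp W U) \subset separation Y V ->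
    separation Y (sv_comp W U) = set0 \/
    separation Y (sv_comp W U) = separation Y V.
  move=> Ut sUV; have [->|->] := minsep _ (tope_comp WO Ut) sUV; last by right.
  by left; apply/setP=> f; rewrite tope_sep // eqxx inE.
have sepW_sub U : U \in topes ->
    separation Y (sv_comp W U) \subset separation Y V.
  move=> Ut; apply/subsetP=> f; apply: contraLR => fS.
  by rewrite tope_sep ?tope_comp // ffunE WY // (negPf (Y0 f)) eqxx.
(* Compose W with Y, then with the opposite of Y: the former agrees with Y at e,
   hence by minimality at f, and the latter at neither. If W were nonzero at f,
   both would have the sign of W there. *)
have W0 f : f \in separation Y V -> W f = Zero.
  move=> fS; apply/eqP.
  have WYe : W f != Zero -> W f = Y f.
    move=> Wf0; have /sepW/(_ (sepW_sub _ Yt)) := Yt.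
    case=> /setP sepE; last first.
      by have := sepE e; rewrite eS tope_sep ?tope_comp // ffunE We !eqxx.
    have := sepE f; rewrite in_set0 tope_sep ?tope_comp // comp_nonzero //.
    by move/negbFE/eqP.
  apply: contraT => Wf0; have Yn := tope_opp Yt.
  have [] := sepW _ Yn (sepW_sub _ Yn) => /setP sepE.
    have := sepE e; rewrite in_set0 tope_sep ?tope_comp // ffunE We eqxx ffunE.
    by have := Y0 e; case: (Y e).
  have := sepE f; rewrite fS tope_sep ?tope_comp // comp_nonzero //.
  by rewrite WYe // eqxx.
have sep1 f : f \in separation Y V -> f = e.
  move=> fS; apply/eqP; apply: contraT => nefe.
  (* A tope that agrees with Y at e but not at f. *)
  have [T [TO Tf Te]] := simpleO nefe.
  have Tf' : {in [set f], forall g, T g = Zero}.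
    by move=> g; rewrite inE => /eqP->.
  have [U [UO Uf Ue]] := covector_signed TO Tf' Te (Y0 e).
  have {}Uf : U f = Zero by apply: Uf; rewrite inE.
  have YUt := tope_comp UO (tope_opp Yt).
  have [] := sepW _ YUt (sepW_sub _ YUt) => /setP sepE.
    have := sepE f; rewrite in_set0 (tope_sep _ Yt (tope_comp WO YUt)).
    rewrite comp_at_zero ?W0 // comp_at_zero // ffunE.
    by have := Y0 f; case: (Y f).
  have := sepE e; rewrite eS (tope_sep _ Yt (tope_comp WO YUt)).
  by rewrite comp_at_zero // comp_nonzero Ue ?eqxx // Y0.
exists e; last by rewrite -tope_sep // (subsetP sVZ).
rewrite inE (_ : facet Y e = W) //; apply/ffunP=> f; rewrite ffunE.
have [->//|nefe] := eqVneq f e.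
by rewrite WY //; apply: contra nefe => /sep1->.
Qed.

(** Composing [Z] with the opposite of [Y] yields a tope that agrees with [Y]
    only where [Z] does. *)
Lemma covector_facet Y Z : Y \in topes -> Z \in covectors O -> Z != Y ->
  exists2 e, e \in facets Y & Z e != Y e.
Proof.
move=> Yt ZO neZY; have [_ Y0] := topesP _ Yt.
have Yn := tope_opp Yt.
have oppY e : opp_sign (Y e) != Y e by have := Y0 e; case: (Y e).
have neZ : sv_comp Z (sv_opp Y) != Y.
  apply: contra neZY => /eqP/ffunP eqY; apply/eqP/ffunP=> e.
  have := eqY e; rewrite ffunE; case: ifP => // _.
  by rewrite ffunE => /eqP; rewrite (negPf (oppY e)).
have [e eF neY] := facet_separates Yt (tope_comp ZO Yn) neZ.
exists e => //; have [Ze0 | Ze] := eqVneq (Z e) Zero.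
  by rewrite Ze0 eq_sym.
by rewrite comp_nonzero in neY.
Qed.

End Topes.

(** * Incidences between topes and facets *)

Section Incidences.
Variables (E : finType) (O : oriented_matroid E).

Lemma card_topes : #|topes O| = #|cells O set0 setT|.
Proof.
apply: eq_card => Y; apply/topesP/cellsP => [[YO Y0]|[X [XO _ XS ->]]].
  exists Y; split=> // [e|]; first by rewrite inE.
  by apply/ffunP=> e; rewrite ffunE inE.
have -> : restrict setT X = X by apply/ffunP=> e; rewrite ffunE inE.
by split=> // e; apply: XS.
Qed.

(** A tope having [e] as a facet is determined by that facet and its own sign at
    [e]: an arc borders at most two regions. *)
Lemma card_topes_facet e :
  #|[set Y in topes O | e \in facets O Y]|
    <= #|cells O [set e] (~: [set e])| * 2.
Proof.
pose h (Y : {ffun E -> sign}) := (facet Y e, Y e == Pos).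
rewrite -card_bool -cardsT -cardsX.
have inj_h : {in [set Y in topes O | e \in facets O Y] &, injective h}.
  move=> Y Y' /setIdP[/topesP[_ /(_ e) Ye] _] /setIdP[/topesP[_ /(_ e) Y'e] _].
  move=> [/ffunP eqF eqe]; apply/ffunP=> f.
  have [->|nefe] := eqVneq f e; last first.
    by have := eqF f; rewrite !ffunE (negPf nefe).
  by move: eqe Ye Y'e; case: (Y e); case: (Y' e).
rewrite -(card_in_imset inj_h); apply/subset_leq_card/subsetP => _
  /imsetP[Y /setIdP[/topesP[YO Y0] eF] ->]; rewrite in_setX inE andbT.
apply/cellsP; exists (facet Y e); split.
- by rewrite inE in eF.
- by move=> f; rewrite inE ffunE => ->.
- by move=> f; rewrite !inE ffunE => /negPf->.
- apply/ffunP=> f; rewrite !ffunE !inE.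
  by case: eqP.
Qed.

Lemma sum_facets :
  \sum_(Y in topes O) #|facets O Y|
    <= 2 * \sum_e #|cells O [set e] (~: [set e])|.
Proof.
rewrite (eq_bigr (fun Y => \sum_e (e \in facets O Y : nat))); last first.
  move=> Y _; rewrite -sum1_card [LHS]big_mkcond /=.
  by apply: eq_bigr => e _; case: ifP.
rewrite exchange_big /= big_distrr /=; apply: leq_sum => e _.
rewrite mulnC; apply: leq_trans (card_topes_facet e).
rewrite -sum1_card big_mkcond [X in _ <= X]big_mkcond /=.
by apply: leq_sum => Y _; rewrite [in leqRHS]inE; case: (Y \in topes O);
  case: (e \in _).
Qed.

End Incidences.

(** * Euler's formula and the inequality *)

(** A line through [e] that meets [f |: S] but not [S] passes through [f];
    there is only one such line. *)
Lemma meeting_setU1 (T : finType) (F : {set {set T}}) (e f : T)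
    (S L : {set T}) :
    L \in F -> e \in L -> f \in L ->
    (forall K, K \in F -> e \in K -> f \in K -> K = L) ->
  [set K in F | (e \in K) && ~~ [disjoint f |: S & K]] =
  L |: [set K in F | (e \in K) && ~~ [disjoint S & K]].
Proof.
move=> FL eL fL uniqL; apply/setP=> K; rewrite !inE.
have [-> | neKL] := eqVneq K L.
  by rewrite FL eL /=; apply/pred0Pn; exists f; rewrite /= setU11.
case FK: (K \in F) => //=; case eK: (e \in K) => //=.
have fK : f \notin K by apply: contra neKL => fK; rewrite (uniqL K).
rewrite -![[disjoint _ & K]]setI_eq0 setIUl setU_eq0.
by rewrite [X in ~~ (X && _)]setI_eq0 disjoints1 fK.
Qed.

Section Melchior.
Variables (E : finType) (M : matroid E) (O : oriented_matroid E).
Hypotheses (simpleM : simple_matroid M) (rankM : rank M = 3).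
Hypothesis flatsO : zero_sets O = flats M.
Implicit Types (S L : {set E}).

Let lines := flats_of_rank M 2.

Lemma flat_covector A e : A \in flats M -> e \notin A ->
  exists V, [/\ V \in covectors O, {in A, forall f, V f = Zero} & V e != Zero].
Proof.
rewrite -flatsO => /imsetP[V VO ->]; rewrite inE => Ve.
by exists V; split=> // f; rewrite inE => /eqP.
Qed.

Lemma covectors_simple e f : e != f ->
  exists V, [/\ V \in covectors O, V e = Zero & V f != Zero].
Proof.
move=> neef; have [|V [VO Ve Vf]] := @flat_covector [set e] f (flat1 simpleM e).
  by rewrite inE eq_sym.
by exists V; split=> //; apply: Ve; rewrite inE.
Qed.

(** Each line through [e] that meets [S] is a pair of antipodal points cut out on
    the circle [e], and [k > 0] such pairs cut a circle into [2 * k] arcs. Adding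
    [f] adds a pair unless the line through [e] and [f] already meets [S]. The
    last summand accounts for the uncut circle. *)
Lemma card_cells_point e S : e \notin S ->
  #|cells O [set e] S| =
    2 * #|[set L in lines | (e \in L) && ~~ [disjoint S & L]]| + (S == set0).
Proof.
elim/set_ind: S => [_ | f S fS IHS efS].
  rewrite card_cells0 eqxx (_ : [set L in _ | _] = set0) ?cards0 //.
  by apply/setP=> L; rewrite !inE -setI_eq0 set0I eqxx !andbF.
have [neef eS] : e != f /\ e \notin S.
  by move: efS; rewrite !inE negb_or => /andP[].
have [V [VO Ve Vf]] := covectors_simple neef.
have VA : {in [set e], forall g, V g = Zero} by move=> g; rewrite inE => /eqP->.
rewrite (card_cells_split fS VO VA Vf) IHS //.
have [L [lineL eL fL]] := line_through simpleM neef.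
rewrite (meeting_setU1 S lineL eL fL); last first.
  by move=> K lineK eK fK; exact: (line_unique simpleM lineK lineL neef).
rewrite cardsU1.
have -> : (f |: S == set0) = false.
  by apply/negbTE/set0Pn; exists f; rewrite setU11.
have inD : (L \in [set K in lines | (e \in K) && ~~ [disjoint S & K]])
    = ~~ [disjoint S & L] by rewrite inE lineL eL.
rewrite inD negbK addn0 -/lines.
suff -> : #|cells O (f |: [set e]) S| =
    (if S == set0 then 1 else 2 * [disjoint S & L]).
  have [S0 | _] := eqVneq S set0; last by rewrite addn0 mulnDr addnC.
  have -> : [disjoint S & L] by rewrite S0 -setI_eq0 set0I.
  by rewrite /=; lia.
have [disSL|] := boolP [disjoint S & L]; last first.
  case/pred0Pn=> g /andP[gS gL].
  rewrite (@cells_degenerate _ _ _ _ g) ?cards0 //.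
    by rewrite (negbTE (_ : S != set0)) //; apply/set0Pn; exists g.
  move=> X XO XA; have /subsetP/(_ g gL) : L \subset zero_set X.
    apply: (line_sub simpleM lineL eL fL neef).
    - by rewrite -flatsO imset_f.
    - by rewrite inE XA // !inE eqxx orbT.
    - by rewrite inE XA // !inE eqxx.
  by rewrite inE => /eqP.
have [->|S0] := eqVneq S set0; first by rewrite card_cells0.
rewrite (@card_cells_cocircuit _ _ _ _ L) ?flatsO //.
- by move=> C CF; apply: (line_coatom rankM lineL).
- exact: line_flat lineL.
- move=> C CF; rewrite subUset !sub1set => /andP[fC eC].
  exact: (line_sub simpleM lineL eL fL neef).
- by rewrite subUset !sub1set fL eL.
Qed.

(** Euler's formula. Adding the curve [e] to a nonempty [S] adds as many cells as
    there are arcs on [e], that is, two for each line through [e] that meets [S];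
    these are the lines for which [#|L :&: S| - 1] grows by one. The subtraction
    is truncated: a line that does not meet [S] is no vertex and counts for
    zero. *)
Lemma card_cells_plane S :
  #|cells O set0 S| =
    2 * (\sum_(L in lines) (#|L :&: S| - 1)) + (if S == set0 then 1 else 2).
Proof.
elim/set_ind: S => [|e S eS IHS].
  by rewrite card_cells0 eqxx big1 // => L _; rewrite setI0 cards0.
have [V [VO _ Ve]] := flat_covector (flat0_rank simpleM).1 (negbT (in_set0 e)).
have V0 : {in set0, forall g, V g = Zero} by move=> g; rewrite inE.
rewrite (card_cells_split eS VO V0 Ve) setU0 card_cells_point // IHS.
have -> : (e |: S == set0) = false.
  by apply/negbTE/set0Pn; exists e; rewrite setU11.
have -> : \sum_(L in lines) (#|L :&: (e |: S)| - 1) =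
    \sum_(L in lines) (#|L :&: S| - 1)
    + #|[set L in lines | (e \in L) && ~~ [disjoint S & L]]|.
  rewrite -sum1_card [X in _ + X]big_mkcond [X in _ + X]/=.
  rewrite [X in _ + X](_ : _ =
    \sum_(L in lines) ((e \in L) && ~~ [disjoint S & L])); last first.
    rewrite [RHS]big_mkcond; apply: eq_bigr => L _; rewrite inE.
    by case: (L \in lines) => //=; case: (_ && _).
  rewrite -big_split; apply: eq_bigr => L _ /=.
  rewrite setIUr [L :&: [set e]]setIC.
  have [eL|eL] := boolP (e \in L).
    rewrite (setIidPl _) ?sub1set // cardsU1 inE eL eS /= disjoint_sym.
    rewrite -setI_eq0 -card_gt0; lia.
  rewrite (_ : [set e] :&: L = set0) ?set0U ?addn0 //.
  by apply/eqP; rewrite setI_eq0 disjoints1.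
by case: ifP => _; lia.
Qed.

(** If the facets of [Y] were at most two, some element [g] would lie outside a
    flat of rank at most 2 containing them. On the curve of [g] there is a
    covector that agrees with [Y] at all the facets of [Y], although it is not
    [Y], which contradicts [covector_facet]. *)
Lemma facets_ge3 Y : Y \in topes O -> 2 < #|facets O Y|.
Proof.
move=> Yt; have [YO Y0] := topesP _ _ Yt.
rewrite ltnNge; apply/negP=> leF2.
suff [U [UO [g Ug] UF]] : exists U, [/\ U \in covectors O,
    exists g, U g = Zero & {in facets O Y, U =1 Y}].
  have neUY : U != Y by apply: contra (Y0 g) => /eqP <-; apply/eqP.
  have [e eF] := covector_facet covectors_simple Yt UO neUY.
  by rewrite UF ?eqxx.
have ne_rank A : rank_flat M A != 3 -> exists g, g \notin A.
  move=> rA; have : A \proper setT.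
    by rewrite properT; apply: contra rA => /eqP->; apply/eqP.
  by case/properP=> _ [g _ gA]; exists g.
move: leF2; rewrite leq_eqVlt ltnS leq_eqVlt ltnS leqn0 => /or3P[].
- case/cards2P=> e [f [neef ->]].
  have [L [lineL eL fL]] := line_through simpleM neef.
  have [g gL] : exists g, g \notin L.
    by apply: ne_rank; move: lineL; rewrite inE => /andP[_ /eqP->].
  (* The line through x and g misses y, so a covector vanishing on it can take
     any sign at y. Two of these compose to the covector sought. *)
  have half x y : x != y -> x \in L -> y \in L -> exists U,
      [/\ U \in covectors O, U g = Zero, U x = Zero & U y = Y y].
    move=> nexy xL yL.
    have nexg : x != g by apply: contra gL => /eqP<-.
    have [K [lineK xK gK]] := line_through simpleM nexg.
    have yK : y \notin K.
      apply: contra gL => yK.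
      by rewrite (line_unique simpleM lineL lineK nexy).
    have [V [VO VK Vy]] := flat_covector (line_flat lineK) yK.
    have [U [UO UK Uy]] := covector_signed VO VK Vy (Y0 y).
    by exists U; split=> //; apply: UK.
  have [U [UO Ug Uf Ue]] := half f e (contra_neq esym neef) fL eL.
  have [W [WO Wg We Wf]] := half e f neef eL fL.
  exists (sv_comp U W); split; first exact: covectorsC.
    by exists g; rewrite comp_zero.
  move=> x; rewrite !inE => /orP[] /eqP->.
    by rewrite comp_nonzero Ue.
  by rewrite comp_at_zero.
- case/cards1P=> e ->.
  have [g] : exists g, g \notin [set e].
    by apply: ne_rank; rewrite (flat1_rank simpleM e).2.
  rewrite inE => nege.
  have [V [VO Vg Ve]] := covectors_simple nege.
  have Vg' : {in [set g], forall f, V f = Zero}.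
    by move=> f; rewrite inE => /eqP->.
  have [U [UO Ug Ue]] := covector_signed VO Vg' Ve (Y0 e).
  exists U; split=> //; first by exists g; apply: Ug; rewrite inE.
  by move=> f; rewrite inE => /eqP->.
- rewrite cards_eq0 => /eqP->.
  have [g _] : exists g : E, g \notin set0.
    by apply: ne_rank; rewrite (flat0_rank simpleM).2.
  exists (sv0 E); split; first exact: covectors0.
    by exists g; rewrite ffunE.
  by move=> f; rewrite inE.
Qed.

Lemma melchior : \sum_(L in lines) #|L| + 3 <= 3 * #|lines|.
Proof.
have setT0 : ([set: E] == set0) = false.
  apply/negbTE/eqP=> T0; move: rankM; rewrite /rank T0.
  by rewrite (flat0_rank simpleM).2.
have F3 : 3 * #|topes O| <= \sum_(Y in topes O) #|facets O Y|.
  by rewrite mulnC -sum_nat_const; apply: leq_sum => Y /facets_ge3.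
have := leq_trans F3 (sum_facets O).
rewrite card_topes card_cells_plane setT0.
have -> : \sum_(L in lines) (#|L :&: setT| - 1) =
    \sum_(L in lines) #|L| - #|lines|.
  rewrite -sum1_card -sumnB; first by apply: eq_bigr => L _; rewrite setIT.
  by move=> L /(line_neq0 simpleM).
have : \sum_e #|cells O [set e] (~: [set e])| <= 2 * \sum_(L in lines) #|L|.
  rewrite (eq_bigr (fun L : {set E} => \sum_e (e \in L : nat))); last first.
    move=> L _; rewrite -sum1_card big_mkcond.
    by apply: eq_bigr => e _; case: ifP.
  rewrite exchange_big big_distrr; apply: leq_sum => e _.
  rewrite card_cells_point ?inE ?eqxx //.
  have -> : (~: [set e] == set0) = false.
    apply/negbTE/eqP => /(congr1 (@setC E)); rewrite setCK setC0 => eT.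
    by move: rankM; rewrite /rank -eT (flat1_rank simpleM e).2.
  rewrite addn0 leq_mul2l -sum1_card big_mkcond [leqRHS]big_mkcond /=.
  apply: leq_sum => L _; rewrite inE; case: (L \in lines) => //=.
  by case: (e \in L) => //=; case: (~~ _).
have : #|lines| <= \sum_(L in lines) #|L|.
  by rewrite -sum1_card; apply: leq_sum => L /(line_neq0 simpleM).
lia.
Qed.

End Melchior.

Theorem corollary1p3 (E : finType) (M : matroid E) (c s : nat) :
  simple_matroid M ->
  rank M = 3 ->
  c = #|flats_of_rank M 2| ->
  s = \sum_(L in flats_of_rank M 2) #|L| ->
  (3 * (c%:Z - 1) < s%:Z)%R ->
  ~ orientable M.
Proof.
move=> simpleM rankM -> -> lt3 [O flatsO].
by have := melchior simpleM rankM flatsO; lia.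
Qed.
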